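(* Let $\mathscr H$ be a complex Hilbert space and let $\mathbf{T}=(T_1,\dots,T_d)\in\mathbb{B}(\mathscr H)^d$ be commuting (i.e. $T_iT_j=T_jT_i$ for all $i,j$). Then the following are equivalent: (a) $r(\mathbf{T})=\|\mathbf{T}\|$; (b) $w_e(\mathbf{T})=\|\mathbf{T}\|$.
   Context: $\mathbb{B}(\mathscr H)$ denotes the bounded linear operators on $\mathscr H$. $w_e(\mathbf{T})=\sup\{(\sum_{k=1}^d|\langle T_kx,x\rangle|^2)^{1/2}: \|x\|=1\}$, $\|\mathbf{T}\|=\sup\{(\sum_{k=1}^d\|T_kx\|^2)^{1/2}: \|x\|=1\}$. For a commuting tuple, $\sigma(\mathbf{T})\subseteq\mathbb{C}^d$ is its (Taylor) joint spectrum, and the joint spectral radius is $r(\mathbf{T})=\sup\{(\sum_{k=1}^d|z_k|^2)^{1/2}:(z_1,\dots,z_d)\in\sigma(\mathbf{T})\}$. The joint approximate point spectrum $\sigma_\pi(\mathbf{T})$ is the set of $(\lambda_1,\dots,\lambda_d)\in\mathbb{C}^d$ for which there are unit vectors $x_n$ with $\|(T_k-\lambda_kI)x_n\|\to0$ for all $k$; it satisfies $\sigma_\pi(\mathbf{T})\subseteq\sigma(\mathbf{T})$, and $r(\mathbf{T})\le w_e(\mathbf{T})$ for commuting tuples. *)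

(* Defs.v *)
From HB Require Import structures.
From mathcomp Require Import all_boot all_order all_algebra.
From mathcomp Require Import all_classical all_reals all_analysis.
From mathcomp Require Import complex.
Import Order.TTheory GRing.Theory Num.Theory.
Import numFieldNormedType.Exports.

Set Implicit Arguments.
Unset Strict Implicit.
Unset Printing Implicit Defensive.

Local Open Scope ring_scope.
Local Open Scope classical_set_scope.

Section JointSpectrum.
Variable R : realType.

Definition cmod (z : R[i]) : R := complex.Re `|z|.

Definition is_inner_product (V : normedModType R[i]) (ip : V -> V -> R[i]) :=
  [/\ forall (a : R[i]) (x y z : V), ip (a *: x + y) z = a * ip x z + ip y z,
      forall x y : V, ip y x = (ip x y)^*
    & forall x : V, ip x x = `|x| ^+ 2].

Variable V : normedModType R[i].

Definition vnorm (x : V) : R := complex.Re `|x|.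

Variable d : nat.

(* Koszul complex of (T_1 - lam_1, ..., T_d - lam_d) on the exterior algebra
   Lambda(C^d) (x) H; an element is a family of vectors indexed by subsets
   J of {0..d-1} (coefficient of e_J).  Boundary:
   d(x e_{i_1} /\ ... /\ e_{i_k}) = sum_m (-1)^(m-1) (T_{i_m}-lam_{i_m}) x e_{.. ^i_m ..}. *)
Definition koszul_d (T : 'I_d -> {linear V -> V}) (lam : 'I_d -> R[i])
  (f : {set 'I_d} -> V) : {set 'I_d} -> V :=
  fun J => \sum_(j : 'I_d | j \notin J)
     ((-1) ^+ #|[set i in J | (i < j)%N]|) *:
       (T j (f (j |: J)) - lam j *: f (j |: J)).

(* exactness of the (whole, graded) Koszul complex: ker = im in every degree *)
Definition koszul_exact (T : 'I_d -> {linear V -> V}) (lam : 'I_d -> R[i]) :=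
  (forall g, koszul_d T lam (koszul_d T lam g) = (fun=> 0)) /\
  (forall f, koszul_d T lam f = (fun=> 0) -> exists g, f = koszul_d T lam g).

Definition taylor_spectrum (T : 'I_d -> {linear V -> V}) : set ('I_d -> R[i]) :=
  [set lam | ~ koszul_exact T lam].

Definition euclid_norm (z : 'I_d -> R[i]) : R :=
  Num.sqrt (\sum_(k < d) cmod (z k) ^+ 2).

Definition joint_spectral_radius (T : 'I_d -> {linear V -> V}) : R :=
  sup [set euclid_norm z | z in taylor_spectrum T].

Definition unit_sphere : set V := [set x | vnorm x = 1].

Definition joint_norm (T : 'I_d -> {linear V -> V}) : R :=
  sup [set Num.sqrt (\sum_(k < d) vnorm (T k x) ^+ 2) | x in unit_sphere].

Definition joint_numerical_radius (ip : V -> V -> R[i])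
  (T : 'I_d -> {linear V -> V}) : R :=
  sup [set Num.sqrt (\sum_(k < d) cmod (ip (T k x) x) ^+ 2) | x in unit_sphere].

End JointSpectrum.

(* Main.v *)
(* Write N = ||T||; always r <= w_e <= N.

   r <= w_e: if |lam| > w_e, then |lam|^2 - sum_k conj(lam_k) T_k is coercive, hence
   bijective by Lax-Milgram. So sum_k a_k (T_k - lam_k) is invertible for suitable
   scalars a_k, and exterior multiplication by a contracts the Koszul complex.

   If w_e = N > 0, compactness gives lam with |lam| = N and unit vectors x with
   T_k x - lam_k x arbitrarily small. Put C = N^-2 sum_k conj(lam_k) T_k and
   P_k = T_k - lam_k C. By Pythagoras N^2 |C z|^2 + sum_k |P_k z|^2 = sum_k |T_k z|^2
   <= N^2 |z|^2, so C is a contraction almost fixing x, hence C^* x ~ x. Since P_k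
   commutes with C, <P_k z, x> ~ <P_k C^m z, x> for every m, while the sum over m of
   |P_k C^m z|^2 is at most N^2 |z|^2; thus P_k^* x ~ 0 and (T_k - lam_k)^* x ~ 0.
   A gliding hump then yields a vector outside the sum of the ranges of the
   T_k - lam_k, so the Koszul complex is not exact in its last degree and lam lies in
   the Taylor spectrum. *)
Require Import Defs.
From HB Require Import structures.
From mathcomp Require Import all_boot all_order all_algebra.
From mathcomp Require Import all_classical all_reals all_analysis.
From mathcomp Require Import complex.
From mathcomp Require Import ring lra.
Import Order.TTheory GRing.Theory Num.Theory.
Import numFieldNormedType.Exports.
Local Open Scope ring_scope.

(** * Modulus of a complex number as a real number *)

Section ComplexModulus.
Set Implicit Arguments.
Unset Strict Implicit.
Variable R : realType.
Implicit Types z w : R[i].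

Lemma cmodE z : `|z| = (cmod z)%:C%C.
Proof. by rewrite /cmod normc_def. Qed.

Lemma cmod_ge0 z : 0 <= cmod z.
Proof. by rewrite -lecR -cmodE normr_ge0. Qed.

Lemma cmod0 : cmod (0 : R[i]) = 0.
Proof. by apply: complexI; rewrite -cmodE normr0. Qed.

Lemma cmodM z w : cmod (z * w) = cmod z * cmod w.
Proof. by apply: complexI; rewrite rmorphM /= -!cmodE normrM. Qed.

Lemma cmodD z w : cmod (z + w) <= cmod z + cmod w.
Proof. by rewrite -lecR rmorphD /= -!cmodE ler_normD. Qed.

Lemma cmodN z : cmod (- z) = cmod z.
Proof. by rewrite /cmod normrN. Qed.

Lemma cmodB z w : cmod (z - w) <= cmod z + cmod w.
Proof. by rewrite -(cmodN w) cmodD. Qed.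

Lemma cmodJ z : cmod z^*%C = cmod z.
Proof. by rewrite /cmod normcJ. Qed.

Lemma cmod_real (x : R) : cmod x%:C%C = `|x|.
Proof. by rewrite /cmod normc_def /= expr0n addr0 sqrtr_sqr. Qed.

Lemma cmod_sum (I : finType) (P : pred I) (F : I -> R[i]) :
  cmod (\sum_(i | P i) F i) <= \sum_(i | P i) cmod (F i).
Proof.
elim/big_ind2 : _ => [|x1 x2 y1 y2 h1 h2|//]; first by rewrite cmod0.
by rewrite (le_trans (cmodD _ _)) ?lerD.
Qed.

Lemma cmod_sqr z : cmod z ^+ 2 = complex.Re z ^+ 2 + complex.Im z ^+ 2.
Proof. by apply: complexI; rewrite add_Re2_Im2 rmorphXn /= -cmodE. Qed.

Lemma mulcJ z : z * z^*%C = (cmod z ^+ 2)%:C%C.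
Proof. by rewrite rmorphXn /= -cmodE sqr_normc. Qed.

Lemma Re_le_cmod z : complex.Re z <= cmod z.
Proof.
rewrite (le_trans (ler_norm _))// -lecR -cmodE; exact: normc_ge_Re.
Qed.

Lemma Re_mulr (x : R) z : complex.Re (x%:C%C * z) = x * complex.Re z.
Proof. by case: z => a b /=; rewrite mul0r subr0. Qed.

Lemma Re_conjc z : complex.Re z^*%C = complex.Re z.
Proof. by case: z. Qed.

End ComplexModulus.

(** * Norm of a vector as a real number *)

Section VectorNorm.
Set Implicit Arguments.
Unset Strict Implicit.
Variables (R : realType) (V : normedModType R[i]).
Implicit Types x y : V.

Lemma vnormE x : `|x| = (vnorm x)%:C%C.
Proof.
by rewrite /vnorm; have /ger0_Im := normr_ge0 x; case: `|x| => a b /= ->.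
Qed.

Lemma vnorm_ge0 x : 0 <= vnorm x.
Proof. by rewrite -lecR -vnormE normr_ge0. Qed.

Lemma vnorm_eq0 x : vnorm x = 0 -> x = 0.
Proof. by move=> h; apply/eqP; rewrite -normr_eq0 vnormE h. Qed.

Lemma vnorm0 : vnorm (0 : V) = 0.
Proof. by apply: complexI; rewrite -vnormE normr0. Qed.

Lemma vnormZ (a : R[i]) x : vnorm (a *: x) = cmod a * vnorm x.
Proof. by apply: complexI; rewrite rmorphM /= -cmodE -!vnormE normrZ. Qed.

Lemma vnormD x y : vnorm (x + y) <= vnorm x + vnorm y.
Proof. by rewrite -lecR rmorphD /= -!vnormE ler_normD. Qed.

Lemma vnormN x : vnorm (- x) = vnorm x.
Proof. by rewrite /vnorm normrN. Qed.

Lemma vnorm_sum (I : finType) (P : pred I) (F : I -> V) :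
  vnorm (\sum_(i | P i) F i) <= \sum_(i | P i) vnorm (F i).
Proof.
elim/big_ind2 : _ => [|x1 x2 y1 y2 h1 h2|//]; first by rewrite vnorm0.
by rewrite (le_trans (vnormD _ _)) ?lerD.
Qed.

Lemma vnorm_gt0 x : x != 0 -> 0 < vnorm x.
Proof.
by move=> x0; rewrite lt_def vnorm_ge0 andbT; apply: contraNneq x0 => /vnorm_eq0 ->.
Qed.

Lemma continuous_linear_vnorm_bounded (f : {linear V -> V}) :
  continuous f -> exists2 K, 0 <= K & forall x, vnorm (f x) <= K * vnorm x.
Proof.
move=> /linear_bounded_continuous/linear_boundedP/pinfty_ex_gt0[r r0 hr].
have rE : r = (complex.Re r)%:C%C by rewrite RRe_real ?gtr0_real.
exists (complex.Re r); first by rewrite -lecR -rE ltW.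
by move=> x; rewrite -lecR rmorphM /= -rE -!vnormE.
Qed.

End VectorNorm.

(** * Sequences with geometrically decreasing steps *)

Section GeometricConvergence.
Local Open Scope classical_set_scope.
Set Implicit Arguments.
Unset Strict Implicit.
Variable R : realType.

Lemma exists_geometric_lt (C q e : R) : 0 <= q < 1 -> 0 < e ->
  exists n, C * q ^+ n < e.
Proof.
move=> /andP[q0 q1] e0.
have : (fun n => C * q ^+ n) @ \oo --> C * 0.
  by apply: cvgMr; apply: cvg_expr; rewrite ger0_norm.
rewrite mulr0 => /cvgrPdist_lt/(_ _ e0)[N _ /(_ N (leqnn N))].
rewrite /= sub0r normrN => h; exists N; exact: le_lt_trans (ler_norm _) h.
Qed.

Lemma geometric_steps_cvg (V : completeNormedModType R[i]) (u : nat -> V) (C q : R) :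
    0 <= q < 1 -> (forall n, vnorm (u n.+1 - u n) <= C * q ^+ n) ->
  exists l, forall n, vnorm (l - u n) <= C * q ^+ n / (1 - q).
Proof.
move=> q01 hu; have /andP[q0 q1] := q01.
have q1' : 0 < 1 - q by rewrite subr_gt0.
have C0 : 0 <= C by have := hu 0; rewrite expr0 mulr1; apply/le_trans/vnorm_ge0.
have dist n m : vnorm (u (n + m)%N - u n) <= C * q ^+ n / (1 - q).
  (* The exact finite geometric sum is what makes the induction on [m] close. *)
  have : vnorm (u (n + m)%N - u n) <= C * q ^+ n * (1 - q ^+ m) / (1 - q).
    elim: m => [|m IH].
      by rewrite addn0 subrr vnorm0 expr0 subrr mulr0 mul0r.
    rewrite addnS -(subrK (u (n + m)%N) (u _.+1)) -addrA.
    rewrite (le_trans (vnormD _ _))// (le_trans (lerD (hu _) IH))//.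
    rewrite exprS exprD le_eqVlt; apply/orP; left; apply/eqP; field.
    by rewrite subr_eq0 gt_eqF.
  move/le_trans; apply; apply: ler_wpM2r; first by rewrite invr_ge0 ltW.
  rewrite ler_piMr ?mulr_ge0 ?exprn_ge0//.
  by rewrite lerBlDr lerDl exprn_ge0.
have small e : 0 < e -> exists N, C * q ^+ N / (1 - q) < e.
  move=> e0; have [N hN] := exists_geometric_lt (C / (1 - q)) q01 e0.
  by exists N; rewrite mulrAC.
have : cvgn u.
  apply/cauchy_cvgP/cauchy_exP => e e0.
  have eE : e = (complex.Re e)%:C%C by rewrite RRe_real ?gtr0_real.
  have {}e0 : 0 < complex.Re e by rewrite -ltcR -eE.
  have [N hN] := small _ e0.
  exists (u N), N => // m /= Nm; rewrite -ball_normE /ball_ /= eE vnormE ltcR.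
  by rewrite -opprB vnormN (le_lt_trans _ hN)// -(subnKC Nm) dist.
move=> /cvg_ex[l ul]; exists l => n; apply/ler_addgt0Pl => e e0.
have ec0 : 0 < e%:C%C :> R[i] by rewrite ltcR.
have /cvgrPdist_lt/(_ _ ec0)[N _ hN] := ul.
have {}hN := hN (n + N)%N (leq_addl _ _); rewrite /= vnormE ltcR in hN.
rewrite -(subrK (u (n + N)%N) l) -addrA (le_trans (vnormD _ _))// lerD ?dist//.
exact: ltW.
Qed.

End GeometricConvergence.

(** * Hermitian forms on a complex vector space *)

Section HermitianForm.
Set Implicit Arguments.
Unset Strict Implicit.
Variables (R : realType) (V : lmodType R[i]) (Q : V -> V -> R[i]).
Hypothesis Qlin : forall (a : R[i]) (x y z : V),
  Q (a *: x + y) z = a * Q x z + Q y z.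
Hypothesis Qherm : forall x y : V, Q y x = (Q x y)^*%C.

Lemma formDl x y z : Q (x + y) z = Q x z + Q y z.
Proof. by rewrite -[x]scale1r Qlin mul1r scale1r. Qed.

Lemma form0l z : Q 0 z = 0.
Proof. by apply/(addrI (Q 0 z)); rewrite -formDl !addr0. Qed.

Lemma formZl a x z : Q (a *: x) z = a * Q x z.
Proof. by rewrite -[a *: x]addr0 Qlin form0l addr0. Qed.

Lemma formNl x z : Q (- x) z = - Q x z.
Proof. by rewrite -scaleN1r formZl mulN1r. Qed.

Lemma formBl x y z : Q (x - y) z = Q x z - Q y z.
Proof. by rewrite formDl formNl. Qed.

Lemma form_suml (I : finType) (F : I -> V) z :
  Q (\sum_i F i) z = \sum_i Q (F i) z.
Proof. exact: (big_morph (fun x => Q x z) (fun x y => formDl x y z) (form0l z)). Qed.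

Lemma formDr x y z : Q x (y + z) = Q x y + Q x z.
Proof. by rewrite (Qherm _ x) formDl rmorphD /= -!Qherm. Qed.

Lemma formZr a x z : Q x (a *: z) = a^*%C * Q x z.
Proof. by rewrite (Qherm _ x) formZl rmorphM /= -!Qherm. Qed.

Lemma formNr x z : Q x (- z) = - Q x z.
Proof. by rewrite (Qherm _ x) formNl rmorphN /= -!Qherm. Qed.

Lemma formBr x y z : Q x (y - z) = Q x y - Q x z.
Proof. by rewrite formDr formNr. Qed.

Lemma Re_formC x y : complex.Re (Q x y) = complex.Re (Q y x).
Proof. by rewrite Qherm Re_conjc. Qed.

Lemma Re_form_sqrB x y :
  complex.Re (Q (x - y) (x - y)) =
  complex.Re (Q x x) - complex.Re (Q x y) *+ 2 + complex.Re (Q y y).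
Proof.
rewrite formBl !formBr !raddfB /= (Re_formC y x) mulr2n; ring.
Qed.

(** Definiteness is not assumed, so that the defect form <z, w> - <C z, C w> of a contraction is
    covered as well as the inner product. The proof expands Q(v, v) >= 0 at v = x - s Q(x, y) y for
    real s. *)
Lemma form_cauchy_schwarz x y : (forall z, 0 <= complex.Re (Q z z)) ->
  cmod (Q x y) ^+ 2 <= complex.Re (Q x x) * complex.Re (Q y y).
Proof.
move=> Qpos; set c := cmod (Q x y) ^+ 2.
set a := complex.Re (Q x x); set b := complex.Re (Q y y).
have a0 : 0 <= a := Qpos x.
have b0 : 0 <= b := Qpos y.
have c0 : 0 <= c by exact: sqr_ge0.
have key (s : R) : 0 <= a - s * c *+ 2 + s ^+ 2 * c * b.
  have := Qpos (x - (s%:C%C * Q x y) *: y).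
  rewrite Re_form_sqrB formZl !formZr -/a.
  have -> : (s%:C%C * Q x y)^*%C = s%:C%C * (Q x y)^*%C.
    by rewrite rmorphM; congr (_ * _); exact: conjc_real.
  rewrite -[_ * _^*%C * Q x y]mulrA (mulrC _^*%C) mulcJ -rmorphM.
  have -> : s%:C%C * Q x y * (s%:C%C * (Q x y)^*%C * Q y y) =
    (s ^+ 2 * c)%:C%C * Q y y.
    by rewrite rmorphM rmorphXn /= -mulcJ; ring.
  by rewrite Re_mulr -/b.
(* For b > 0 the optimal s is 1/b. For b = 0 the bound a - 2 s c >= 0 is affine in s, and s = (a +
   1)/c violates it unless c = 0. *)
have [bz|bnz] := eqVneq b 0; last first.
  have bpos : 0 < b by rewrite lt_def bnz.
  have := key b^-1.
  have -> : a - b^-1 * c *+ 2 + b^-1 ^+ 2 * c * b = a - c / b.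
    by rewrite mulr2n; field.
  by rewrite subr_ge0 ler_pdivrMr.
have [cz|cnz] := eqVneq c 0; first by rewrite cz mulr_ge0.
have := key ((a + 1) / c).
rewrite bz mulr0 addr0 divfK// => h; exfalso; rewrite mulr2n in h; lra.
Qed.

End HermitianForm.

(** * Inner product identities *)

Section InnerProduct.
Set Implicit Arguments.
Unset Strict Implicit.
Variables (R : realType) (V : normedModType R[i]) (ip : V -> V -> R[i]).
Hypothesis Hip : is_inner_product ip.
Implicit Types x y z : V.

Lemma ip_linl (a : R[i]) x y z : ip (a *: x + y) z = a * ip x z + ip y z.
Proof. by case: Hip. Qed.

Lemma ip_herm x y : ip y x = (ip x y)^*%C.
Proof. by case: Hip. Qed.

Lemma ip_vnorm x : ip x x = (vnorm x ^+ 2)%:C%C.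
Proof. by case: Hip => _ _ ->; rewrite vnormE rmorphXn. Qed.

Lemma ip_cauchy_schwarz x y : cmod (ip x y) <= vnorm x * vnorm y.
Proof.
rewrite -ler_sqr ?nnegrE ?mulr_ge0 ?cmod_ge0 ?vnorm_ge0//.
have := form_cauchy_schwarz ip_linl ip_herm x y.
rewrite !ip_vnorm /= exprMn; apply => z.
by rewrite ip_vnorm /= exprn_ge0 ?vnorm_ge0.
Qed.

Lemma vnorm_sqrB x y :
  vnorm (x - y) ^+ 2 = vnorm x ^+ 2 - complex.Re (ip x y) *+ 2 + vnorm y ^+ 2.
Proof. by have := Re_form_sqrB ip_linl ip_herm x y; rewrite !ip_vnorm /=. Qed.

(** Pythagoras for the projection onto the line of [y]. Taken at T_k x and x, it measures how far x
    is from an eigenvector by the gap between |T_k x| and |<T_k x, x>|. *)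
Lemma vnorm_sqr_proj x y : vnorm y = 1 ->
  vnorm (x - ip x y *: y) ^+ 2 = vnorm x ^+ 2 - cmod (ip x y) ^+ 2.
Proof.
move=> y1; rewrite vnorm_sqrB vnormZ y1 mulr1.
rewrite (formZr ip_linl ip_herm) mulrC mulcJ /= mulr2n; ring.
Qed.

End InnerProduct.

(** * The Koszul complex: boundary, homotopy and last degree *)

Section KoszulComplex.
Set Implicit Arguments.
Unset Strict Implicit.
Variables (R : realType) (V : normedModType R[i]) (d : nat).
Variables (T : 'I_d -> {linear V -> V}) (lam : 'I_d -> R[i]).
Implicit Types (i j : 'I_d) (J : {set 'I_d}) (g : {set 'I_d} -> V).

Let B j x := T j x - lam j *: x.
Let sgn j J : R[i] := (-1) ^+ #|[set i in J | (i < j)%N]|.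

Let koszulE g J :
  koszul_d T lam g J = \sum_(j | j \notin J) sgn j J *: B j (g (j |: J)).
Proof. by []. Qed.

Let B0 j : B j 0 = 0.
Proof. by rewrite /B linear0 scaler0 subr0. Qed.

Let BZ j a x : B j (a *: x) = a *: B j x.
Proof. by rewrite /B linearZ /= scalerBr !scalerA mulrC. Qed.

Let BD j x y : B j (x + y) = B j x + B j y.
Proof. by rewrite /B linearD scalerDr opprD addrACA. Qed.

Let B_sum j (P : pred 'I_d) (F : 'I_d -> V) :
  B j (\sum_(i | P i) F i) = \sum_(i | P i) B j (F i).
Proof. exact: (big_morph (B j) (BD j) (B0 j)). Qed.

Let BC i j x : (forall i j, T i \o T j = T j \o T i) -> B i (B j x) = B j (B i x).
Proof.
move=> Tcomm; have BB k l : B k (B l x) =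
    T k (T l x) - (lam l *: T k x + lam k *: T l x) + (lam k * lam l) *: x.
  rewrite /B raddfB /= linearZ /= scalerBr scalerA opprB opprD !addrA.
  by rewrite [RHS]addrAC.
rewrite !BB addrC [RHS]addrC (mulrC (lam i)) (addrC (lam j *: _)).
by have /(congr1 (@^~ x)) /= -> := Tcomm i j.
Qed.

(** The new index j is counted by [sgn i] exactly when it precedes i; every sign computation below
    reduces to this. The case i = j is allowed and contributes no sign. *)
Let sgnU j i J : j \notin J -> sgn i (j |: J) = (-1) ^+ (j < i)%N * sgn i J.
Proof.
move=> jJ; rewrite /sgn -exprD; congr (_ ^+ _).
case: ltnP => ji.
  have -> : [set k in j |: J | (k < i)%N] = j |: [set k in J | (k < i)%N].
    by apply/setP => k; rewrite !inE; case: eqVneq => // ->; rewrite ji.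
  by rewrite cardsU1 inE (negPf jJ).
rewrite add0n; apply: eq_card => k; rewrite !inE; case: eqVneq => // ->.
by rewrite (negPf jJ) ltnNge ji.
Qed.

Let sgn2 j J : sgn j J * sgn j J = 1.
Proof. by rewrite /sgn -expr2 sqrr_sign. Qed.

(** Removing i and j in either order gives the same vector, since the operators commute, but
    opposite signs. The double sum is thus its own negative. *)
Lemma koszul_d_squared g : (forall i j, T i \o T j = T j \o T i) ->
  koszul_d T lam (koszul_d T lam g) = fun=> 0.
Proof.
move=> Tcomm; apply/funext => J; rewrite koszulE.
(* Extending the summand by 0 to all pairs makes the two summation ranges independent, so they can
   be exchanged. *)
pose F j i := if [&& j \notin J, i \notin J & i != j] then
  (sgn j J * ((-1) ^+ (j < i)%N * sgn i J)) *: B j (B i (g (i |: (j |: J)))) else 0.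
have -> : \sum_(j | j \notin J) sgn j J *: B j (koszul_d T lam g (j |: J)) =
    \sum_j \sum_i F j i.
  rewrite big_mkcond; apply: eq_bigr => j _; case: ifP => jJ; last first.
    by rewrite big1 // => i _; rewrite /F jJ.
  rewrite koszulE B_sum scaler_sumr big_mkcond; apply: eq_bigr => i _.
  rewrite /F jJ in_setU1 negb_or andbC /=; case: ifP => // /andP[iJ ij].
  by rewrite BZ scalerA sgnU.
have FN j i : F i j = - F j i.
  rewrite /F; have [->|ij] := eqVneq i j; first by rewrite !andbF oppr0.
  rewrite !andbT andbC; case: ifP => // _; last by rewrite oppr0.
  rewrite (BC _ _ _ Tcomm) finset.setUCA -scaleNr; congr (_ *: _).
  have -> : (-1) ^+ (j < i)%N = - (-1) ^+ (i < j)%N :> R[i].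
    by case: (ltngtP j i) ij => [| |/val_inj ->]; rewrite ?eqxx //= ?opprK.
  ring.
set S := \sum_j _; have SN : S = - S.
  rewrite {1}/S exchange_big -sumrN; apply: eq_bigr => j _.
  by rewrite -sumrN; apply: eq_bigr => i _; rewrite FN.
have /eqP : 2%:R *: S = 0 by rewrite scaler_nat mulr2n {1}SN addNr.
by rewrite scaler_eq0 pnatr_eq0 /= => /eqP.
Qed.

(* Contracting homotopy: exterior multiplication by the covector [a]. *)
Let wedge (a : 'I_d -> R[i]) g J :=
  \sum_(i in J) (sgn i J * a i) *: g (J :\ i).

(** This is the homotopy formula d(a /\ g) + a /\ dg = (sum_i a_i B_i) g, restricted to cycles,
    where the second term vanishes. *)
Let koszul_d_wedge a g : koszul_d T lam g = (fun=> 0) ->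
  koszul_d T lam (wedge a g) = fun J => \sum_i a i *: B i (g J).
Proof.
move=> dg0; apply/funext => J; rewrite koszulE.
have sgnD1 i : i \in J -> sgn i J = sgn i (J :\ i).
  by move=> iJ; rewrite -{1}(finset.setD1K iJ) sgnU ?setD11// ltnn mul1r.
(* The cycle condition at J minus i, solved for its term of index i. *)
have rel i : i \in J -> sgn i J *: B i (g J) =
    - \sum_(j | j \notin J) sgn j (J :\ i) *: B j (g (j |: (J :\ i))).
  move=> iJ; have /(congr1 (@^~ (J :\ i))) := dg0; rewrite koszulE.
  rewrite (bigD1 i) ?setD11//= finset.setD1K// -sgnD1// => /eqP.
  rewrite addr_eq0 => /eqP ->; congr (- _); apply: eq_bigl => j.
  rewrite in_setD1 negb_and negbK; case: eqVneq => //= [->|_]; first by rewrite iJ.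
  by rewrite andbT.
(* The index j itself yields a_j B_j (g J). Summed over j, the remaining terms become, by [rel], the
   a_i B_i (g J) with i in J. *)
have step j : j \notin J -> sgn j J *: B j (wedge a g (j |: J)) =
    a j *: B j (g J) - \sum_(i in J) (a i * sgn i J) *:
      (sgn j (J :\ i) *: B j (g (j |: (J :\ i)))).
  move=> jJ; rewrite /wedge B_sum (big_setU1 _ jJ) /= scalerDr; congr (_ + _).
    by rewrite BZ scalerA finset.setU1K// sgnU// ltnn mul1r mulrA sgn2 mul1r.
  rewrite scaler_sumr -sumrN; apply: eq_bigr => i iJ.
  have ij : i != j by apply: contraNneq jJ => <-.
  have -> : (j |: J) :\ i = j |: (J :\ i).
    by apply/setP => k; rewrite !inE; case: (eqVneq k j) => // ->; rewrite eq_sym ij.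
  rewrite BZ !scalerA -scaleNr; congr (_ *: _).
  rewrite sgnU// -{1}(finset.setD1K iJ) sgnU ?setD11//.
  have -> : (-1) ^+ (j < i)%N = - (-1) ^+ (i < j)%N :> R[i].
    by case: (ltngtP j i) ij => [| |/val_inj ->]; rewrite ?eqxx //= ?opprK.
  by case: (i < j)%N; rewrite ?expr1 ?expr0; ring.
rewrite (eq_bigr _ step) sumrB exchange_big /= [in RHS](bigID (mem J)) /=.
rewrite addrC; congr (_ + _); rewrite -sumrN; apply: eq_bigr => i iJ.
rewrite -scaler_sumr -[X in - (_ *: X)]opprK -rel// scalerN opprK scalerA.
by rewrite -mulrA sgn2 mulr1.
Qed.

(** The operator A = sum_i a_i B_i commutes with the boundary. For a cycle f, the family g = A^-1 f
    is again a cycle because A is injective, and the homotopy formula gives f = A g = d(a /\ g). *)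
Lemma koszul_exact_of_bijective (a : 'I_d -> R[i]) :
    (forall i j, T i \o T j = T j \o T i) ->
    bijective (fun x => \sum_i a i *: (T i x - lam i *: x)) ->
  koszul_exact T lam.
Proof.
move=> Tcomm [A' A'K AK]; pose A x := \sum_i a i *: B i x.
split=> [g|f df0]; first exact: koszul_d_squared.
pose g J := A' (f J); have AgE J : A (g J) = f J by exact: AK.
have dg0 : koszul_d T lam g = fun=> 0.
  apply/funext => J; apply: (can_inj A'K); rewrite -[LHS]/(A _) -[RHS]/(A _).
  rewrite [RHS]big1 => [|i _]; last by rewrite B0 scaler0.
  have /(congr1 (@^~ J)) := df0; rewrite koszulE => <-.
  rewrite koszulE /A.
  under eq_bigr do rewrite B_sum scaler_sumr.
  rewrite exchange_big /=; apply: eq_bigr => j _.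
  rewrite -AgE /A B_sum scaler_sumr; apply: eq_bigr => i _.
  by rewrite !BZ (BC _ _ _ Tcomm) !scalerA mulrC.
by exists (wedge a g); rewrite koszul_d_wedge//; apply/funext => J; rewrite -AgE.
Qed.

(** The family carrying y at the empty set only is a cycle, as nothing lies below degree 0.
    Exactness makes it a boundary, and its coefficient at the empty set is a sum of elements of the
    ranges. *)
Lemma koszul_exact_sum_range y : koszul_exact T lam ->
  exists z : 'I_d -> V, y = \sum_j (T j (z j) - lam j *: z j).
Proof.
move=> [_ exact_d]; pose f J : V := if J == finset.set0 then y else 0.
have df0 : koszul_d T lam f = fun=> 0.
  apply/funext => J; rewrite koszulE big1// => j _; rewrite /f ifN ?B0 ?scaler0//.
  by apply/set0Pn; exists j; rewrite setU11.
have [g /(congr1 (@^~ finset.set0))] := exact_d _ df0.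
rewrite koszulE /f eqxx => ->.
exists (fun j => sgn j finset.set0 *: g (j |: finset.set0)).
by apply: eq_big => [j|j _]; rewrite ?inE// -BZ.
Qed.

End KoszulComplex.

(** * Two consequences of completeness: Lax-Milgram and the gliding hump *)

Section HilbertSpace.
Set Implicit Arguments.
Unset Strict Implicit.
Variables (R : realType) (V : completeNormedModType R[i]) (ip : V -> V -> R[i]).
Hypothesis Hip : is_inner_product ip.

(* Lax-Milgram, by the contraction x |-> x - t (S x - y) with t small. *)
Lemma coercive_surjective (S : {linear V -> V}) (K c : R) : 0 < c ->
    (forall x, vnorm (S x) <= K * vnorm x) ->
    (forall x, c * vnorm x ^+ 2 <= complex.Re (ip (S x) x)) ->
  forall y, exists x, S x = y.
Proof.
move=> c0 SK Sc y.
(* [K] may be negative or smaller than c; with M >= c > 0 the quantity 1 - c^2/M^2 below is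
   nonnegative. *)
pose M := `|K| + c.
have M0 : 0 < M by rewrite ltr_wpDl.
have cM : c <= M by rewrite lerDr.
have SM x : vnorm (S x) <= M * vnorm x.
  rewrite (le_trans (SK x))// ler_wpM2r ?vnorm_ge0//.
  by rewrite (le_trans (ler_norm K))// lerDl ltW.
(* This t minimises 1 - 2 t c + t^2 M^2, the bound on the squared contraction factor; q^2 is the
   minimum. *)
pose t := c / M ^+ 2; pose q := Num.sqrt (1 - c ^+ 2 / M ^+ 2).
have M20 : 0 < M ^+ 2 by rewrite exprn_gt0.
have r0 : 0 <= 1 - c ^+ 2 / M ^+ 2.
  by rewrite subr_ge0 ler_pdivrMr// mul1r lerXn2r// nnegrE ltW.
have q0 : 0 <= q by exact: sqrtr_ge0.
have q1 : q < 1.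
  by rewrite -[ltRHS]sqrtr1 ltr_sqrt ?ltr01// ltrBlDr ltrDl divr_gt0 ?exprn_gt0.
have contr x : vnorm (x - t%:C%C *: S x) <= q * vnorm x.
  rewrite -ler_sqr ?nnegrE ?mulr_ge0 ?vnorm_ge0// exprMn sqr_sqrtr//.
  rewrite (vnorm_sqrB Hip) vnormZ cmod_real exprMn real_normK ?num_real//.
  rewrite (formZr (ip_linl Hip) (ip_herm Hip)).
  have -> : (t%:C%C)^*%C = t%:C%C by exact: conjc_real.
  rewrite Re_mulr (Re_formC (ip_herm Hip)).
  have h1 := Sc x.
  have h2 : vnorm (S x) ^+ 2 <= M ^+ 2 * vnorm x ^+ 2.
    by rewrite -exprMn ler_sqr ?nnegrE ?mulr_ge0 ?vnorm_ge0 ?(ltW M0).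
  have t0 : 0 <= t by rewrite divr_ge0 ?ltW.
  have h3 : t * (c * vnorm x ^+ 2) <= t * complex.Re (ip (S x) x).
    exact: ler_wpM2l.
  have h4 : t ^+ 2 * vnorm (S x) ^+ 2 <= t ^+ 2 * (M ^+ 2 * vnorm x ^+ 2).
    by apply: ler_wpM2l => //; exact: sqr_ge0.
  have e1 : t * (c * vnorm x ^+ 2) = c ^+ 2 / M ^+ 2 * vnorm x ^+ 2.
    by rewrite /t; field; rewrite gt_eqF.
  have e2 : t ^+ 2 * (M ^+ 2 * vnorm x ^+ 2) = c ^+ 2 / M ^+ 2 * vnorm x ^+ 2.
    by rewrite /t; field; rewrite gt_eqF.
  rewrite e1 in h3; rewrite e2 in h4; rewrite mulr2n mulrBl mul1r; lra.
pose f x := x - t%:C%C *: (S x - y).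
have fB x z : f x - f z = (x - z) - t%:C%C *: S (x - z).
  rewrite /f (linearB S) !scalerBr !opprB !addrA.
  by rewrite [LHS](ACl (1*6*4*3*(2*5)))/= subrr addr0.
pose u n := iter n f 0.
have steps n : vnorm (u n.+1 - u n) <= vnorm (u 1%N - u 0%N) * q ^+ n.
  elim: n => [|n IH]; first by rewrite expr0 mulr1.
  rewrite [u n.+2]/(f (u n.+1)) [u n.+1]/(f (u n)) fB -/(u n.+1).
  by rewrite (le_trans (contr _))// exprS mulrCA ler_wpM2l.
have q01 : 0 <= q < 1 by rewrite q0.
have [l hl] := geometric_steps_cvg q01 steps.
exists l; have fl : f l = l.
  apply/eqP; rewrite -subr_eq0; apply/eqP/vnorm_eq0/eqP; rewrite eq_le vnorm_ge0.
  rewrite andbT; apply/ler_addgt0Pl => e e0; rewrite addr0.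
  set C := vnorm (u 1%N - u 0%N) in hl.
  have [n hn] := exists_geometric_lt (C / (1 - q) *+ 2) q01 e0.
  rewrite -(subrK (u n.+1) (f l)) -addrA (le_trans (vnormD _ _))//.
  rewrite (le_trans _ (ltW hn))// mulr2n mulrDl lerD//.
    rewrite fB (le_trans (contr _))// mulrAC (le_trans _ (hl n))//.
    by rewrite ler_piMl ?vnorm_ge0 ?ltW.
  rewrite -opprB vnormN (le_trans (hl _))//.
  have -> : C * q ^+ n.+1 / (1 - q) = q * (C / (1 - q) * q ^+ n).
    by rewrite exprS; ring.
  rewrite ler_piMl ?(ltW q1)// mulrAC; exact: le_trans (vnorm_ge0 _) (hl n).
move: fl; rewrite /f => /eqP; rewrite -subr_eq0 addrAC subrr add0r oppr_eq0.
rewrite scaler_eq0 subr_eq0 => /orP[|/eqP//].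
rewrite eq_complex /= eqxx andbT => /eqP t0.
by have := divr_gt0 c0 M20; rewrite -/t t0 ltxx.
Qed.

(* Gliding hump: y is the limit of y_n+1 = y_n +- 3^-n x_n, where the sign keeps
   the n-th functional large at y_n+1. *)
Lemma gliding_hump (x : nat -> V) : (forall n, vnorm (x n) = 1) ->
  exists y, forall n, (3^-1 ^+ n) / 2 <= cmod (ip y (x n)).
Proof.
move=> x1; pose q : R := 3^-1.
pose step y n := let h := (q ^+ n)%:C%C *: x n in
  if q ^+ n <= cmod (ip (y + h) (x n)) then y + h else y - h.
have stepP y n : q ^+ n <= cmod (ip (step y n) (x n)).
  rewrite /step; case: ifPn => //; rewrite -ltNge => lt1.
  set h := _ *: x n in lt1 *.
  have qn0 : 0 <= q ^+ n by rewrite exprn_ge0// invr_ge0.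
  have qh : cmod (ip h (x n)) = q ^+ n.
    by rewrite (formZl (ip_linl Hip)) (ip_vnorm Hip) x1 expr1n mulr1 cmod_real ger0_norm.
  (* The two candidate values differ by 2 q^n in modulus, so one of them has modulus at least
     q^n. *)
  have : ip h (x n) + ip h (x n) = ip (y + h) (x n) - ip (y - h) (x n).
    by rewrite (formBl (ip_linl Hip)) (formDl (ip_linl Hip)); ring.
  move=> /(congr1 (@cmod R)); rewrite -mulr2n -mulr_natl cmodM qh.
  have -> : cmod (2%:R : R[i]) = 2.
    by rewrite -(rmorph_nat (real_complex R)) cmod_real ger0_norm.
  have := cmodB (ip (y + h) (x n)) (ip (y - h) (x n)); lra.
have step_dist y n : vnorm (step y n - y) <= 1 * q ^+ n.
  have qn0 : 0 <= q ^+ n by rewrite exprn_ge0// invr_ge0.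
  rewrite mul1r /step; case: ifP => _; rewrite addrAC subrr add0r ?vnormN;
  by rewrite vnormZ x1 mulr1 cmod_real ger0_norm.
pose fix u n := if n is m.+1 then step (u m) m else 0.
have q01 : 0 <= q < 1 by rewrite /q invr_ge0 ler0n/= invf_lt1// ltr1n.
have [y hy] := geometric_steps_cvg (u := u) q01 (fun n => step_dist (u n) n).
exists y => n; have h1 := stepP (u n) n; rewrite -[step _ _]/(u n.+1) in h1.
have h2 := ip_cauchy_schwarz Hip (y - u n.+1) (x n); rewrite x1 mulr1 in h2.
have h3 := hy n.+1; rewrite mul1r exprS in h3.
(* With q = 1/3 all later steps together move y by at most half of the n-th hump. *)
have h4 : q * q ^+ n / (1 - q) = q ^+ n / 2 by rewrite /q; field.
rewrite h4 in h3.
have : ip (u n.+1) (x n) = ip y (x n) - ip (y - u n.+1) (x n).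
  by rewrite (formBl (ip_linl Hip)); ring.
move=> /(congr1 (@cmod R)) e; rewrite e in h1.
have := cmodB (ip y (x n)) (ip (y - u n.+1) (x n)).
rewrite -/q; lra.
Qed.

End HilbertSpace.

Lemma linear_pack (R : pzRingType) (V : lmodType R) (f : V -> V) :
  linear f -> exists g : {linear V -> V}, g = f :> (V -> V).
Proof.
move=> lf; pose m := GRing.isLinear.Build _ _ _ _ f lf.
by pose g : {linear V -> V} := HB.pack f m; exists g.
Qed.

(** * Vectors almost fixed by a contraction *)

Section AlmostFixedVectors.
Set Implicit Arguments.
Unset Strict Implicit.
Variables (R : realType) (V : normedModType R[i]) (ip : V -> V -> R[i]).
Hypothesis Hip : is_inner_product ip.

(* Cauchy-Schwarz for the positive form <z, w> - <C z, C w>. *)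
Lemma contraction_almost_fixed (C : {linear V -> V}) (x : V) (eta nu : R) :
    (forall z, vnorm (C z) <= vnorm z) -> vnorm x = 1 ->
    vnorm (C x - x) <= eta -> 0 < nu <= 1 -> 8 * eta <= nu ^+ 2 ->
  forall z, cmod (ip (z - C z) x) <= nu * vnorm z.
Proof.
move=> Cle x1 Cx /andP[nu0 nu1] eta_nu z.
pose Q u v := ip u v - ip (C u) (C v).
have Qlin (a : R[i]) u v w : Q (a *: u + v) w = a * Q u w + Q v w.
  by rewrite /Q linearP !(ip_linl Hip); ring.
have Qherm u v : Q v u = (Q u v)^*%C.
  by rewrite /Q (ip_herm Hip) (ip_herm Hip (C u)) -rmorphB.
have ReQ u : complex.Re (Q u u) = vnorm u ^+ 2 - vnorm (C u) ^+ 2.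
  by rewrite /Q raddfB /= !(ip_vnorm Hip).
have Qpos u : 0 <= complex.Re (Q u u).
  by rewrite ReQ subr_ge0 ler_sqr ?nnegrE ?vnorm_ge0.
have := form_cauchy_schwarz Qlin Qherm z x Qpos; rewrite !ReQ x1 expr1n => h1.
have Cx1 : 1 <= vnorm (C x) + eta.
  have := vnormD (C x) (x - C x); rewrite addrCA subrr addr0 x1.
  by rewrite -(opprB (C x)) vnormN; lra.
(* The left side is at most 2 (1 - |C x|) <= 2 eta, and 8 eta <= nu^2. *)
have h2 : 1 - vnorm (C x) ^+ 2 <= (nu / 2) ^+ 2.
  have := Cle x; have := vnorm_ge0 (C x); rewrite x1; nra.
have h3 : cmod (Q z x) <= vnorm z * (nu / 2).
  have nu20 : 0 <= vnorm z * (nu / 2) by rewrite mulr_ge0 ?vnorm_ge0 ?divr_ge0 ?ltW.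
  rewrite -ler_sqr ?nnegrE ?cmod_ge0// exprMn (le_trans h1)// ler_pM//.
  - by have := Qpos z; rewrite ReQ.
  - by have := Qpos x; rewrite ReQ x1 expr1n.
  - by rewrite gerBl sqr_ge0.
have h4 : cmod (ip (C z) (C x - x)) <= vnorm z * (nu / 2).
  rewrite (le_trans (ip_cauchy_schwarz Hip _ _))// ler_pM ?vnorm_ge0//.
  by rewrite (le_trans Cx)//; nra.
have -> : ip (z - C z) x = Q z x + ip (C z) (C x - x).
  rewrite /Q (formBl (ip_linl Hip)) (formBr (ip_linl Hip) (ip_herm Hip)); ring.
rewrite (le_trans (cmodD _ _))//; lra.
Qed.

(* The defect |z|^2 - |C z|^2 telescopes along the orbit of z, so [P (C^m z)] is
   small for some m < M; and <P z, x> ~ <C^m P z, x> = <P (C^m z), x>. *)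
Lemma defect_orthogonal_almost_fixed (C P : {linear V -> V}) (x : V) (s e nu : R)
    (M : nat) :
    0 < s -> 0 < e -> 0 <= nu -> s ^+ 2 < M%:R * e ^+ 2 ->
    vnorm x = 1 ->
    (forall z, vnorm (P z) ^+ 2 <= s ^+ 2 * (vnorm z ^+ 2 - vnorm (C z) ^+ 2)) ->
    (forall z, P (C z) = C (P z)) ->
    (forall z, cmod (ip (z - C z) x) <= nu * vnorm z) ->
  forall z, cmod (ip (P z) x) <= (e + M%:R * nu * s) * vnorm z.
Proof.
move=> s0 e0 nu0 Me x1 defect PC fixed z.
have s20 : 0 < s ^+ 2 by rewrite exprn_gt0.
have Cle u : vnorm (C u) <= vnorm u.
  rewrite -ler_sqr ?nnegrE ?vnorm_ge0// -subr_ge0 -(pmulr_rge0 _ s20).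
  exact: le_trans (sqr_ge0 _) (defect u).
have Ple u : vnorm (P u) <= s * vnorm u.
  rewrite -ler_sqr ?nnegrE ?vnorm_ge0 ?mulr_ge0 ?vnorm_ge0 ?(ltW s0)//.
  rewrite exprMn (le_trans (defect u))// ler_wpM2l ?(ltW s20)//.
  by rewrite gerBl sqr_ge0.
have Cnle m u : vnorm (iter m C u) <= vnorm u.
  by elim: m => [|m IH] //=; exact: le_trans (Cle _) IH.
have PCn m u : P (iter m C u) = iter m C (P u).
  by elim: m => [|m IH] //=; rewrite PC IH.
have [->|z0] := eqVneq z 0.
  by rewrite linear0 (form0l (ip_linl Hip)) cmod0 vnorm0 mulr0.
have nz := vnorm_gt0 z0.
(* Otherwise each of the M steps costs more than e^2 |z|^2 out of a total of s^2 |z|^2, against s^2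
   < M e^2. *)
have [m mM small] : exists2 m, (m < M)%N & vnorm (P (iter m C z)) <= e * vnorm z.
  apply: contrapT => no.
  have big m : (m < M)%N -> e * vnorm z < vnorm (P (iter m C z)).
    by move=> mM; rewrite ltNge; apply/negP => le; apply: no; exists m.
  have decay m : (m <= M)%N ->
      s ^+ 2 * vnorm (iter m C z) ^+ 2 <= (s ^+ 2 - m%:R * e ^+ 2) * vnorm z ^+ 2.
    elim: m => [|m IH] mM; first by rewrite mul0r subr0.
    have h := IH (ltnW mM); have h2 := defect (iter m C z).
    have : (e * vnorm z) ^+ 2 <= vnorm (P (iter m C z)) ^+ 2.
      by rewrite ler_sqr ?nnegrE ?vnorm_ge0 ?mulr_ge0 ?(ltW (big _ mM)) ?ltW.
    by rewrite exprMn iterS -natr1; lra.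
  have := decay M (leqnn M); rewrite leNgt => /negP; apply.
  have h : (s ^+ 2 - M%:R * e ^+ 2) * vnorm z ^+ 2 < 0.
    by rewrite pmulr_llt0 ?exprn_gt0// subr_lt0.
  by rewrite (lt_le_trans h)// mulr_ge0// sqr_ge0.
(* One application of [fixed] per iterate of C, each iterate of P z having norm at most s |z|. *)
have tele k : cmod (ip (P z - iter k C (P z)) x) <= k%:R * (nu * (s * vnorm z)).
  elim: k => [|k IH]; first by rewrite subrr (form0l (ip_linl Hip)) cmod0 mul0r.
  rewrite -[P z - _](subrKA (iter k C (P z))) (formDl (ip_linl Hip)).
  rewrite (le_trans (cmodD _ _))// -natr1 mulrDl mul1r lerD// iterS.
  rewrite (le_trans (fixed _))// ler_wpM2l// (le_trans (Cnle _ _))//.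
rewrite -[P z](subrK (iter m C (P z))) (formDl (ip_linl Hip)).
rewrite (le_trans (cmodD _ _))// mulrDl addrC lerD//.
  rewrite -PCn (le_trans (ip_cauchy_schwarz Hip _ _))// x1 mulr1//.
rewrite (le_trans (tele m))// -!mulrA ler_wpM2r ?ler_nat ?(ltnW mM)//.
by rewrite !mulr_ge0 ?(ltW s0) ?(ltW nz).
Qed.

End AlmostFixedVectors.

(** * Criteria for a point to lie outside or inside the Taylor spectrum *)

Section CommutingTuple.
Set Implicit Arguments.
Unset Strict Implicit.
Variables (R : realType) (V : completeNormedModType R[i]) (ip : V -> V -> R[i]).
Hypothesis Hip : is_inner_product ip.
Variables (d : nat) (T : 'I_d -> {linear V -> V}).
Hypothesis Tcomm : forall i j, T i \o T j = T j \o T i.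
Implicit Types lam : 'I_d -> R[i].

Lemma taylor_spectrum_le_numerical_radius (K w : R) lam :
    (forall k x, vnorm (T k x) <= K * vnorm x) -> 0 <= w ->
    (forall x, vnorm x = 1 -> \sum_k cmod (ip (T k x) x) ^+ 2 <= w ^+ 2) ->
  taylor_spectrum T lam -> euclid_norm lam <= w.
Proof.
move=> TK w0 Tw; apply: contraPT; rewrite -ltNge => wL.
set L := euclid_norm lam in wL.
have L2 : L ^+ 2 = \sum_k cmod (lam k) ^+ 2.
  by rewrite sqr_sqrtr// sumr_ge0// => k _; exact: sqr_ge0.
(* With these coefficients, A = L^2 - sum_k conj(lam_k) T_k. *)
pose a k := - (lam k)^*%C.
pose A x := \sum_k a k *: (T k x - lam k *: x).
have Alin : linear A.
  move=> c x y; rewrite /A scaler_sumr -big_split; apply: eq_bigr => k _ /=.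
  rewrite [T k _]linearP (scalerDr (lam k)) opprD addrACA scalerDr.
  by congr (_ + _); rewrite !(scalerBr, scalerA); congr (_ *: _ - _ *: _); ring.
have [S SE] := linear_pack Alin.
have wL2 : w ^+ 2 < L ^+ 2 by rewrite ltrXn2r// nnegrE// (le_trans w0 (ltW wL)).
(* By 2 p q <= p^2 + q^2, the real part of sum_k conj(lam_k) <T_k u, u> is at most (L^2 + w^2)/2 on
   unit vectors; c is what remains of L^2. *)
pose c := (L ^+ 2 - w ^+ 2) / 2.
have c0 : 0 < c by rewrite divr_gt0// subr_gt0.
have AB x : vnorm (A x) <= (\sum_k cmod (lam k) * (K + cmod (lam k))) * vnorm x.
  rewrite (le_trans (vnorm_sum _ _))// mulr_suml ler_sum// => k _.
  rewrite vnormZ cmodN cmodJ -mulrA ler_wpM2l ?cmod_ge0//.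
  by rewrite (le_trans (vnormD _ _))// mulrDl vnormN vnormZ lerD.
have Acu u : vnorm u = 1 -> c <= complex.Re (ip (A u) u).
  move=> u1; have -> : ip (A u) u =
      (L ^+ 2)%:C%C - \sum_k (lam k)^*%C * ip (T k u) u.
    rewrite L2 rmorph_sum /= (form_suml (ip_linl Hip)) -sumrB.
    apply: eq_bigr => k _; rewrite (formZl (ip_linl Hip)) (formBl (ip_linl Hip)).
    by rewrite (formZl (ip_linl Hip)) (ip_vnorm Hip) u1 expr1n /a -mulcJ; ring.
  rewrite raddfB /= raddf_sum /=.
  have : \sum_k complex.Re ((lam k)^*%C * ip (T k u) u) <=
      \sum_k (cmod (lam k) ^+ 2 / 2 + cmod (ip (T k u) u) ^+ 2 / 2).
    apply: ler_sum => k _; rewrite (le_trans (Re_le_cmod _))// cmodM cmodJ.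
    have := sqr_ge0 (cmod (lam k) - cmod (ip (T k u) u)); nra.
  rewrite big_split /= -!mulr_suml -L2; have := Tw u u1; rewrite /c; lra.
have Ac x : c * vnorm x ^+ 2 <= complex.Re (ip (A x) x).
  have [->|x0] := eqVneq x 0.
    rewrite vnorm0 expr0n mulr0 -[in leRHS]SE linear0 (form0l (ip_linl Hip)) //.
  have nx := vnorm_gt0 x0.
  pose u := (vnorm x)^-1%:C%C *: x.
  have u1 : vnorm u = 1 by rewrite vnormZ cmod_real gtr0_norm ?invr_gt0// mulVf ?gt_eqF.
  have -> : x = (vnorm x)%:C%C *: u.
    by rewrite scalerA -rmorphM mulfV ?gt_eqF// scale1r.
  have -> : A ((vnorm x)%:C%C *: u) = (vnorm x)%:C%C *: A u by rewrite -SE linearZ.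
  rewrite (formZl (ip_linl Hip)) (formZr (ip_linl Hip) (ip_herm Hip)).
  have -> : ((vnorm x)%:C%C)^*%C = (vnorm x)%:C%C :> R[i] by exact: conjc_real.
  rewrite !Re_mulr vnormZ u1 mulr1 cmod_real gtr0_norm//.
  by have := Acu u u1; nra.
have Ainj : injective A.
  move=> x y /eqP; rewrite -subr_eq0 -SE -linearB /= SE => /eqP Axy.
  apply/eqP; rewrite -subr_eq0; apply/eqP/vnorm_eq0.
  have := Ac (x - y); rewrite Axy (form0l (ip_linl Hip)) /= => h.
  apply/eqP; rewrite -sqrf_eq0 eq_le sqr_ge0 andbT.
  by rewrite -(pmulr_rle0 _ c0).
have Asurj y : exists x, A x = y.
  by have := coercive_surjective Hip (S := S) c0; rewrite SE => /(_ _ AB Ac y).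
have [A' A'K] := choice Asurj.
suff Abij : bijective A by move/(_ (koszul_exact_of_bijective Tcomm Abij)).
by exists A' => // x; apply: Ainj; rewrite A'K.
Qed.

(** The hypothesis says that (T_k - lam_k)^* x is small, written without adjoints. Were the complex
    exact, the gliding hump vector y would be a sum of (T_j - lam_j) z_j, too nearly orthogonal to
    the x_n. *)
Lemma taylor_spectrum_of_almost_reducing lam :
    (forall e, 0 < e -> exists2 x, vnorm x = 1 &
      forall k z, cmod (ip (T k z - lam k *: z) x) <= e * vnorm z) ->
  taylor_spectrum T lam.
Proof.
move=> red exact_lam; pose q : R := 3^-1.
have q0 n : 0 < q ^+ n by rewrite exprn_gt0// invr_gt0.
(* The errors must be of smaller order than the humps q^n / 2: comparing them bounds n + 1 by 2 Z
   for every n. *)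
have en0 n : 0 < q ^+ n / n.+1%:R by rewrite divr_gt0.
have [x xP] := choice (fun n => let: ex_intro2 x x1 xr := red _ (en0 n) in
  ex_intro (fun x => vnorm x = 1 /\ forall k z,
    cmod (ip (T k z - lam k *: z) x) <= q ^+ n / n.+1%:R * vnorm z) x (conj x1 xr)).
have [y hy] := gliding_hump Hip (fun n => (xP n).1).
have [z yE] := koszul_exact_sum_range y exact_lam.
pose Z := \sum_j vnorm (z j).
have Zn n : n.+1%:R <= 2 * Z.
  have := hy n; rewrite yE (form_suml (ip_linl Hip)) => /le_trans/(_ (cmod_sum _ _)).
  have : \sum_j cmod (ip (T j (z j) - lam j *: z j) (x n)) <= q ^+ n / n.+1%:R * Z.
    by rewrite /Z mulr_sumr; apply: ler_sum => j _; exact: (xP n).2.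
  move=> /[swap] /le_trans /[apply].
  rewrite -/q -mulrA (ler_pM2l (q0 n)) (mulrC _ Z) ler_pdivlMr//; lra.
have := Zn (Num.truncn (2 * Z)); rewrite leNgt truncnS_gt//.
Qed.

(** Here |lam| equals the bound s of the tuple, which makes C a contraction. In T_k - lam_k = P_k -
    lam_k (1 - C) the two terms are handled by the two lemmas on almost fixed vectors. *)
Lemma almost_eigenvector_almost_reducing (s e : R) lam : 0 < s ->
    \sum_k cmod (lam k) ^+ 2 = s ^+ 2 ->
    (forall z, \sum_k vnorm (T k z) ^+ 2 <= s ^+ 2 * vnorm z ^+ 2) -> 0 < e ->
  exists2 delta, 0 < delta & forall x, vnorm x = 1 ->
    (forall k, vnorm (T k x - lam k *: x) <= delta) ->
    forall k z, cmod (ip (T k z - lam k *: z) x) <= e * vnorm z.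
Proof.
move=> s0 lams Ts e0.
pose C z := (s ^- 2)%:C%C *: \sum_k (lam k)^*%C *: T k z.
have s20 : 0 < s ^+ 2 by rewrite exprn_gt0.
have Clin : linear C.
  move=> a u v; rewrite /C scalerA (mulrC a) -scalerA -scalerDr.
  congr (_ *: _); rewrite scaler_sumr -big_split; apply: eq_bigr => k _ /=.
  by rewrite [T k _]linearP scalerDr !scalerA (mulrC a).
have [C' CE] := linear_pack Clin.
have sumE z : \sum_k (lam k)^*%C *: T k z = (s ^+ 2)%:C%C *: C z.
  by rewrite scalerA -rmorphM mulfV ?gt_eqF// scale1r.
pose P k z := T k z - lam k *: C z.
have Plin k : linear (P k).
  move=> a u v; rewrite /P -CE [T k _]linearP [C' _]linearP CE (scalerDr (lam k)).
  by rewrite opprD addrACA scalerBr !scalerA (mulrC a).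
(* The tuple (lam_k C z) is the orthogonal projection of (T_k z) onto the tuples of the form (lam_k
   v). *)
have pyth z : \sum_k vnorm (P k z) ^+ 2 =
    \sum_k vnorm (T k z) ^+ 2 - s ^+ 2 * vnorm (C z) ^+ 2.
  under eq_bigr do rewrite (vnorm_sqrB Hip) (formZr (ip_linl Hip) (ip_herm Hip)) vnormZ exprMn.
  rewrite big_split /= sumrB -mulr_suml lams sumrMnl -raddf_sum /=.
  have -> : \sum_k (lam k)^*%C * ip (T k z) (C z) = (s ^+ 2 * vnorm (C z) ^+ 2)%:C%C.
    under eq_bigr do rewrite -(formZl (ip_linl Hip)).
    rewrite -(form_suml (ip_linl Hip)) sumE (formZl (ip_linl Hip)) (ip_vnorm Hip).
    by rewrite -rmorphM.
  by rewrite /= mulr2n; ring.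
have defect k z : vnorm (P k z) ^+ 2 <= s ^+ 2 * (vnorm z ^+ 2 - vnorm (C z) ^+ 2).
  rewrite mulrBr (@le_trans _ _ (\sum_k vnorm (P k z) ^+ 2))//.
    by rewrite (bigD1 k)//= lerDl sumr_ge0// => i _; exact: sqr_ge0.
  by rewrite pyth lerB.
have Cle z : vnorm (C z) <= vnorm z.
  rewrite -ler_sqr ?nnegrE ?vnorm_ge0// -(ler_pM2l s20) -subr_ge0.
  rewrite (@le_trans _ _ (\sum_k vnorm (P k z) ^+ 2)) ?sumr_ge0//.
    by move=> i _; exact: sqr_ge0.
  by rewrite pyth lerB.
have TC i j z : T i (T j z) = T j (T i z) by have /(congr1 (@^~ z)) := Tcomm i j.
have CT k z : C (T k z) = T k (C z).
  rewrite /C [RHS]linearZ; congr (_ *: _); rewrite [RHS]raddf_sum; apply: eq_bigr => j _.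
  by rewrite TC [RHS]linearZ.
have PC k z : P k (C z) = C (P k z).
  have CB a u v : C (u - a *: v) = C u - a *: C v by rewrite -CE linearB linearZ.
  by rewrite /P CB CT.
have lamle k : cmod (lam k) <= s.
  rewrite -ler_sqr ?nnegrE ?cmod_ge0 ?(ltW s0)// -lams (bigD1 k)//= lerDl.
  by rewrite sumr_ge0// => i _; exact: sqr_ge0.
pose M := (Num.truncn (s ^+ 2 / (e / 2) ^+ 2)).+1.
have Me : s ^+ 2 < M%:R * (e / 2) ^+ 2.
  by rewrite -ltr_pdivrMr ?exprn_gt0 ?divr_gt0// truncnS_gt.
(* Of the M + 1 errors nu s, M come from the estimate of P_k and one from lam_k (1 - C); together
   they use e / 2, and the threshold for P_k uses the other half. *)
pose nu := Num.min 1 (e / 2 / (M.+1%:R * s)).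
have nu0 : 0 < nu by rewrite lt_min ltr01 !divr_gt0 ?mulr_gt0.
have nu1 : nu <= 1 by rewrite ge_min lexx.
have nue : nu * (M.+1%:R * s) <= e / 2.
  by rewrite -ler_pdivlMr ?mulr_gt0// ge_min lexx orbT.
pose Lam := \sum_k cmod (lam k).
have Lam0 : 0 <= Lam by rewrite sumr_ge0// => k _; exact: cmod_ge0.
have Lam1 : 0 < Lam + 1 by rewrite ltr_wpDl.
(* Since |C x - x| <= s^-2 Lam delta, this meets the requirement 8 eta <= nu^2. *)
pose delta := nu ^+ 2 * s ^+ 2 / (8 * (Lam + 1)).
have delta0 : 0 < delta by rewrite divr_gt0 ?mulr_gt0 ?exprn_gt0.
exists delta => // x x1 xlam k z.
have Cx : vnorm (C x - x) <= s ^- 2 * (Lam * delta).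
  have -> : C x - x = (s ^- 2)%:C%C *: \sum_k (lam k)^*%C *: (T k x - lam k *: x).
    under eq_bigr do rewrite scalerBr scalerA mulrC mulcJ.
    rewrite sumrB scalerBr -scaler_suml -rmorph_sum lams scalerA -rmorphM.
    by rewrite mulVf ?gt_eqF// scale1r.
  rewrite vnormZ cmod_real gtr0_norm ?invr_gt0// ler_wpM2l ?invr_ge0 ?(ltW s20)//.
  rewrite (le_trans (vnorm_sum _ _))// mulr_suml ler_sum// => i _.
  by rewrite vnormZ cmodJ ler_wpM2l ?cmod_ge0.
have etanu : 8 * (s ^- 2 * (Lam * delta)) <= nu ^+ 2.
  have -> : 8 * (s ^- 2 * (Lam * delta)) = nu ^+ 2 * (Lam / (Lam + 1)).
    by rewrite /delta; field; rewrite !gt_eqF.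
  by rewrite ler_piMr ?sqr_ge0// ler_pdivrMr// mul1r lerDl.
have nu01 : 0 < nu <= 1 by rewrite nu0.
have fixed : forall z, cmod (ip (z - C' z) x) <= nu * vnorm z.
  by apply: (contraction_almost_fixed Hip (eta := s ^- 2 * (Lam * delta))); rewrite ?CE.
have [P' PE] := linear_pack (Plin k).
have e20 : 0 < e / 2 by rewrite divr_gt0.
have h1 : cmod (ip (P k z) x) <= (e / 2 + M%:R * nu * s) * vnorm z.
  rewrite -PE; apply: (defect_orthogonal_almost_fixed Hip (C := C')) => //.
  - exact: ltW.
  - by move=> u; rewrite PE CE.
  - by move=> u; rewrite PE CE.
have -> : ip (T k z - lam k *: z) x = ip (P k z) x - lam k * ip (z - C z) x.
  rewrite -(formZl (ip_linl Hip)) -(formBl (ip_linl Hip)) /P scalerBr opprB.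
  by rewrite addrA subrK.
rewrite (le_trans (cmodB _ _))// cmodM.
have h2 : cmod (lam k) * cmod (ip (z - C z) x) <= s * (nu * vnorm z).
  by rewrite ler_pM ?cmod_ge0// -CE.
rewrite (le_trans (lerD h1 h2))// mulrA -mulrDl ler_wpM2r ?vnorm_ge0//.
by move: nue; rewrite -natr1; lra.
Qed.

End CommutingTuple.

(** * Bolzano-Weierstrass for complex tuples *)

Section BoundedSequences.
Set Implicit Arguments.
Unset Strict Implicit.
Local Open Scope classical_set_scope.
Variables (R : realType) (d : nat).

Lemma bounded_tuple_sequence_cluster (M : R) (u : nat -> 'I_d -> R[i]) :
    (forall n k, cmod (u n k) <= M) ->
  exists lam : 'I_d -> R[i], forall (e : R) n, 0 < e ->
    exists2 m, (n <= m)%N & forall k, cmod (u m k - lam k) < e.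
Proof.
move=> uM.
(* Real and imaginary parts are laid side by side, so that compactness of a real cube applies. *)
pose v n : 'rV[R]_(d + d) := row_mx (\row_k complex.Re (u n k)) (\row_k complex.Im (u n k)).
pose K : set 'rV[R]_(d + d) := [set w | forall i, `[- M, M] (w ord0 i)].
have Kcpt : compact K.
  by apply: (@rV_compact _ _ (fun=> `[- M, M])) => _; exact: segment_compact.
have vK n : K (v n).
  move=> i; have [k ->|k ->] := split_ordP i.
    rewrite /v row_mxEl mxE /= in_itv /= -ler_norml (le_trans _ (uM n k))//.
    by rewrite -ler_sqr ?nnegrE ?cmod_ge0 ?normr_ge0// real_normK ?num_real//
       cmod_sqr lerDl sqr_ge0.
  rewrite /v row_mxEr mxE /= in_itv /= -ler_norml (le_trans _ (uM n k))//.
  by rewrite -ler_sqr ?nnegrE ?cmod_ge0 ?normr_ge0// real_normK ?num_real//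
     cmod_sqr lerDr sqr_ge0.
have [l [_ cl]] : K `&` cluster (v @ \oo) !=set0.
  by apply: Kcpt; exists 0%N => // n _; exact: vK.
exists (fun k => Complex (l ord0 (lshift d k)) (l ord0 (rshift d k))) => e n e0.
have e20 : 0 < e / 2 by rewrite divr_gt0.
have [w [[m nm <-] lw]] := cl (v @` [set m | (n <= m)%N]) (ball l (e / 2))
  ltac:(by exists n => // m /= nm; exists m) (nbhsx_ballx l _ e20).
exists m => // k; rewrite mx_norm_ball /ball_ /= in lw.
have close i : `|l ord0 i - v m ord0 i| < e / 2.
  apply: le_lt_trans lw; rewrite (_ : l _ _ - _ = (l - v m) ord0 i); last by rewrite !mxE.
  rewrite [leRHS]/Num.norm /= mx_normrE.
  by apply/bigmax_geP; right; exists (ord0, i).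
have := close (lshift d k); have := close (rshift d k).
rewrite /v row_mxEl row_mxEr !mxE => hI hR.
rewrite -ltr_sqr ?nnegrE ?cmod_ge0 ?ltW// cmod_sqr.
move: hI hR; case: (u m k) => a b /=.
rewrite !ltr_norml => /andP[h1 h2] /andP[h3 h4]; nra.
Qed.

End BoundedSequences.

(** * Comparison of the three radii *)

Section JointRadii.
Set Implicit Arguments.
Unset Strict Implicit.
Local Open Scope classical_set_scope.
Variables (R : realType) (V : completeNormedModType R[i]) (ip : V -> V -> R[i]).
Hypothesis Hip : is_inner_product ip.
Variables (d : nat) (T : 'I_d -> {linear V -> V}).
Hypothesis Tcont : forall k, continuous (T k).
Hypothesis Tcomm : forall i j, T i \o T j = T j \o T i.

Local Notation r := (joint_spectral_radius T).
Local Notation w := (joint_numerical_radius ip T).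
Local Notation N := (joint_norm T).

Let T_bounded : exists2 K, 0 <= K & forall k x, vnorm (T k x) <= K * vnorm x.
Proof.
have [K KP] := choice (fun k =>
  let: ex_intro2 K K0 h := continuous_linear_vnorm_bounded (@Tcont k) in
  ex_intro (fun K => 0 <= K /\ forall x, vnorm (T k x) <= K * vnorm x) K (conj K0 h)).
exists (\sum_k K k); first by rewrite sumr_ge0// => k _; exact: (KP k).1.
move=> k x; rewrite (le_trans ((KP k).2 x))// ler_wpM2r ?vnorm_ge0//.
by rewrite (bigD1 k)//= lerDl sumr_ge0// => i _; exact: (KP i).1.
Qed.

(** A set without a supremum gets the default 0, which covers the empty unit sphere of the zero
    space. *)
Let sup_nonneg (A : set R) : (forall a, A a -> 0 <= a) -> 0 <= sup A.
Proof.
move=> A0; have [supA|nsupA] := pselect (has_sup A); last by rewrite sup_out.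
by have [[a Aa] ub] := supA; rewrite (le_trans (A0 a Aa))// ub_le_sup.
Qed.

Let sup_le (A : set R) M : 0 <= M -> (forall a, A a -> a <= M) -> sup A <= M.
Proof.
by move=> M0 AM; have [->|/set0P A0] := eqVneq A set0; rewrite ?sup0// ge_sup.
Qed.

Let r_ge0 : 0 <= r.
Proof. by apply: sup_nonneg => _ [z _ <-]; exact: sqrtr_ge0. Qed.

Let w_ge0 : 0 <= w.
Proof. by apply: sup_nonneg => _ [z _ <-]; exact: sqrtr_ge0. Qed.

Let N_ge0 : 0 <= N.
Proof. by apply: sup_nonneg => _ [z _ <-]; exact: sqrtr_ge0. Qed.

Let le_N x : vnorm x = 1 -> Num.sqrt (\sum_k vnorm (T k x) ^+ 2) <= N.
Proof.
move=> x1; apply: ub_le_sup; last by exists x.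
have [K K0 TK] := T_bounded; exists (Num.sqrt (\sum_(k < d) K ^+ 2)) => _ [z z1 <-].
rewrite ler_wsqrtr// ler_sum// => k _.
by rewrite lerXn2r ?nnegrE ?vnorm_ge0// -[K]mulr1 -z1.
Qed.

Let num_le_norm x : vnorm x = 1 ->
  Num.sqrt (\sum_k cmod (ip (T k x) x) ^+ 2) <= Num.sqrt (\sum_k vnorm (T k x) ^+ 2).
Proof.
move=> x1; rewrite ler_wsqrtr// ler_sum// => k _.
rewrite lerXn2r ?nnegrE ?vnorm_ge0 ?cmod_ge0//.
by rewrite (le_trans (ip_cauchy_schwarz Hip _ _))// x1 mulr1.
Qed.

Let le_w x : vnorm x = 1 -> Num.sqrt (\sum_k cmod (ip (T k x) x) ^+ 2) <= w.
Proof.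
move=> x1; apply: ub_le_sup; last by exists x.
by exists N => _ [z z1 <-]; rewrite (le_trans (num_le_norm z1))// le_N.
Qed.

Lemma numerical_radius_le_norm : w <= N.
Proof. by apply: sup_le => // _ [z z1 <-]; rewrite (le_trans (num_le_norm z1))// le_N. Qed.

Let spectrum_le_w z : taylor_spectrum T z -> euclid_norm z <= w.
Proof.
have [K _ TK] := T_bounded.
apply: (taylor_spectrum_le_numerical_radius Hip Tcomm TK w_ge0) => x x1.
rewrite -ler_sqrt ?sqr_ge0// sqrtr_sqr ger0_norm//; exact: le_w.
Qed.

Lemma spectral_radius_le_numerical_radius : r <= w.
Proof. by apply: sup_le => // _ [y Ty <-]; exact: spectrum_le_w. Qed.

Let norm_sqr_le z : \sum_k vnorm (T k z) ^+ 2 <= N ^+ 2 * vnorm z ^+ 2.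
Proof.
have [->|z0] := eqVneq z 0.
  rewrite vnorm0 big1 ?expr0n ?mulr0// => k _.
  by rewrite linear0 vnorm0 expr0n.
have nz := vnorm_gt0 z0.
pose u := (vnorm z)^-1%:C%C *: z.
have u1 : vnorm u = 1 by rewrite vnormZ cmod_real gtr0_norm ?invr_gt0// mulVf ?gt_eqF.
have := le_N u1; rewrite -ler_sqr ?nnegrE ?sqrtr_ge0//.
rewrite sqr_sqrtr ?sumr_ge0// => [|k _]; last exact: sqr_ge0.
rewrite -(ler_pM2r (exprn_gt0 2 nz)) mulr_suml => /(le_trans _); apply.
apply: ler_sum => k _; rewrite /u linearZ /= vnormZ cmod_real.
rewrite gtr0_norm ?invr_gt0// -exprMn mulrAC mulVf ?mul1r ?gt_eqF//.
Qed.

Lemma norm_le_spectral_radius : w = N -> N <= r.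
Proof.
move=> wN; have [N0|N0] := eqVneq N 0; first by rewrite N0.
have {N0} Npos : 0 < N by rewrite lt_def N0.
(* A missing supremum would give w the default value 0, against w = N > 0. *)
have sup_w : has_sup
    [set Num.sqrt (\sum_(k < d) cmod (ip (T k x) x) ^+ 2) | x in @unit_sphere R V].
  apply: contrapT => /sup_out w0.
  by move: Npos; rewrite -wN /joint_numerical_radius w0 ltxx.
have near_N e : 0 < e -> exists2 x, vnorm x = 1 &
    N ^+ 2 - e < \sum_k cmod (ip (T k x) x) ^+ 2.
  (* For this a, s > N - a >= 0 gives s^2 > N^2 - 2 a N >= N^2 - e. *)
  move=> e0; have a0 : 0 < Num.min (e / (2 * N)) N by rewrite lt_min !divr_gt0 ?mulr_gt0.
  have [_ [x x1 <-]] := sup_adherent a0 sup_w.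
  rewrite -[X in X - _]/w wN => h; exists x => //.
  set a := Num.min _ _ in a0 h; set s := Num.sqrt _ in h.
  have aN : a <= N by rewrite ge_min lexx orbT.
  have ae : a * (2 * N) <= e by rewrite -ler_pdivlMr ?mulr_gt0// ge_min lexx.
  have <- : s ^+ 2 = \sum_k cmod (ip (T k x) x) ^+ 2.
    by rewrite sqr_sqrtr// sumr_ge0// => k _; exact: sqr_ge0.
  have s0 : 0 <= s by exact: sqrtr_ge0.
  nra.
have inv0 n : 0 < n.+1%:R^-1 :> R by rewrite invr_gt0.
have [x xP] := choice (fun n => let: ex_intro2 x x1 h := near_N _ (inv0 n) in
  ex_intro (fun x => vnorm x = 1 /\ _) x (conj x1 h)).
pose u n k := ip (T k (x n)) (x n).
have uN n k : cmod (u n k) <= N.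
  rewrite (le_trans (ip_cauchy_schwarz Hip _ _))// (xP n).1 mulr1.
  rewrite -ler_sqr ?nnegrE ?vnorm_ge0//.
  have := norm_sqr_le (x n); rewrite (xP n).1 expr1n mulr1; apply: le_trans.
  by rewrite (bigD1 k)//= lerDl sumr_ge0// => i _; exact: sqr_ge0.
have u_sum n : N ^+ 2 - n.+1%:R^-1 < \sum_k cmod (u n k) ^+ 2 := (xP n).2.
have [lam lamP] := bounded_tuple_sequence_cluster uN.
(* Summed over k, the squared residuals are at most N^2 minus a quantity exceeding N^2 - 1/(n+1). *)
have near_eigen n k : vnorm (T k (x n) - u n k *: x n) ^+ 2 <= n.+1%:R^-1.
  rewrite (@le_trans _ _ (\sum_k vnorm (T k (x n) - u n k *: x n) ^+ 2))//.
    by rewrite (bigD1 k)//= lerDl sumr_ge0// => i _; exact: sqr_ge0.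
  have -> : \sum_k vnorm (T k (x n) - u n k *: x n) ^+ 2 =
      \sum_k vnorm (T k (x n)) ^+ 2 - \sum_k cmod (u n k) ^+ 2.
    by rewrite -sumrB; apply: eq_bigr => i _; rewrite (vnorm_sqr_proj Hip _ (xP n).1).
  have := norm_sqr_le (x n); rewrite (xP n).1 expr1n mulr1.
  have := u_sum n; move: n.+1%:R^-1 (\sum_k _) => a b.
  lra.
have lam_dist e : 0 < e -> exists n, [/\ n.+1%:R^-1 < e &
    forall k, cmod (u n k - lam k) < e].
  move=> e0; have [m nm mP] := lamP e (Num.truncn e^-1) e0; exists m; split=> //.
  rewrite -[e]invrK ltf_pV2 ?posrE ?invr_gt0// (lt_le_trans (truncnS_gt _))//.
  by rewrite ler_nat.
have lam_norm : \sum_k cmod (lam k) ^+ 2 = N ^+ 2.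
  apply/eqP; rewrite -subr_eq0 -normr_eq0 eq_le normr_ge0 andbT.
  apply/ler_addgt0Pl => e e0; rewrite addr0.
  (* The 1 accounts for the distance of |u_n|^2 from N^2; each coordinate adds at most a (2 N + a)
     <= a (2 N + 1). *)
  pose c := 1 + d%:R * (2 * N + 1).
  have c0 : 0 < c by rewrite ltr_pwDl ?mulr_ge0 ?addr_ge0 ?mulr_ge0 ?ler0n.
  pose a := Num.min 1 (e / c).
  have a0 : 0 < a by rewrite lt_min ltr01 divr_gt0.
  have a1 : a <= 1 by rewrite ge_min lexx.
  have ac : a * c <= e by rewrite -ler_pdivlMr// ge_min lexx orbT.
  have [n [na ulam]] := lam_dist a a0.
  have h1 : `|\sum_k cmod (u n k) ^+ 2 - N ^+ 2| <= a.
    have h' : \sum_k cmod (u n k) ^+ 2 <= N ^+ 2.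
      rewrite -ler_sqrt ?sqr_ge0// sqrtr_sqr ger0_norm//.
      by rewrite (le_trans (le_w (xP n).1))// wN.
    by rewrite ler0_norm ?subr_le0// opprB; have := u_sum n;
      move: n.+1%:R^-1 na (\sum_k _) => p pa q; lra.
  have h2 : `|\sum_k cmod (lam k) ^+ 2 - \sum_k cmod (u n k) ^+ 2| <= d%:R * (a * (2 * N + 1)).
    rewrite -sumrB (le_trans (ler_norm_sum _ _ _))//.
    rewrite (@le_trans _ _ (\sum_(k < d) (a * (2 * N + 1))))//; last first.
      by rewrite sumr_const card_ord -[leLHS]mulr_natl.
    apply: ler_sum => k _; have := ulam k; have := uN n k.
    have := cmod_ge0 (lam k); have := cmod_ge0 (u n k).
    have := cmodB (u n k) (u n k - lam k); rewrite opprB addrC subrK.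
    have := cmodD (u n k - lam k) (lam k); rewrite subrK.
    move=> *; rewrite ler_norml; apply/andP; split; nra.
  rewrite -(subrKA (\sum_k cmod (u n k) ^+ 2)) (le_trans (ler_normD _ _))//.
  by rewrite (le_trans (lerD h2 h1))// (le_trans _ ac)// /c; lra.
have lamE : euclid_norm lam = N by rewrite /euclid_norm lam_norm sqrtr_sqr ger0_norm.
rewrite -{1}lamE; apply: ub_le_sup.
  by exists w => _ [z Tz <-]; exact: spectrum_le_w.
exists lam => //; apply: (taylor_spectrum_of_almost_reducing Hip) => e e0.
have [delta delta0 deltaP] :=
  almost_eigenvector_almost_reducing Hip Tcomm Npos lam_norm norm_sqr_le e0.
(* The first entry controls |u_n - lam|, the second the squared residual of [near_eigen]. *)
pose b := Num.min (delta / 2) ((delta / 2) ^+ 2).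
have b0 : 0 < b by rewrite lt_min exprn_gt0 divr_gt0.
have [n [nb ulam]] := lam_dist b b0.
exists (x n); first exact: (xP n).1.
apply: deltaP; first exact: (xP n).1.
move=> k; rewrite -(subrKA (u n k *: x n)) (le_trans (vnormD _ _))//.
rewrite -scalerBl vnormZ (xP n).1 mulr1.
have h1 : vnorm (T k (x n) - u n k *: x n) <= delta / 2.
  rewrite -ler_sqr ?nnegrE ?vnorm_ge0 ?divr_ge0 ?(ltW delta0)//.
  rewrite (le_trans (near_eigen n k))// (le_trans (ltW nb))//.
  by rewrite ge_min lexx orbT.
have h2 : cmod (u n k - lam k) <= delta / 2.
  by rewrite (le_trans (ltW (ulam k)))// ge_min lexx.
  lra.
Qed.

End JointRadii.

Theorem theorem2p13 (R : realType) (V : completeNormedModType R[i])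
  (ip : V -> V -> R[i]) (Hip : is_inner_product ip)
  (d : nat) (hd : (0 < d)%N) (T : 'I_d -> {linear V -> V})
  (Tcont : forall k, continuous (T k))
  (Tcomm : forall i j, T i \o T j = T j \o T i) :
  joint_spectral_radius T = joint_norm T <->
  joint_numerical_radius ip T = joint_norm T.
Proof.
have rw := spectral_radius_le_numerical_radius Hip Tcont Tcomm.
have wN := numerical_radius_le_norm Hip Tcont.
split=> h; apply/eqP; rewrite eq_le.
  by rewrite wN -h.
by rewrite -{1}h rw (norm_le_spectral_radius Hip Tcont Tcomm h).
Qed.
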